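(* If $C\in(\mathbb{R}^n)^{\otimes k}$ is a cost tensor with exact, approximate, or soft set-optimization structure of complexity $\beta$, then the $\mathsf{MIN}_C$, $\mathsf{AMIN}_C$, and $\mathsf{SMIN}_C$ oracles, respectively, can be computed in $\beta+\mathrm{poly}(n,k)$ time.
   Context: Notation: $[n]=\{1,\dots,n\}$; $\vec{j}=(j_1,\dots,j_k)\in[n]^k$; $\bar{\mathbb{R}}=\mathbb{R}\cup\{-\infty\}$; $\mathrm{smin}_\eta$ of a finite collection $(a_i)$ is $-\frac1\eta\log\sum_ie^{-\eta a_i}$, with $e^{-\infty}=0$, $\log0=-\infty$. Runtimes count arithmetic operations. Oracles. $\mathsf{MIN}_C$: given $p=(p_1,\dots,p_k)\in\mathbb{R}^{n\times k}$, return $\min_{\vec{j}\in[n]^k}C_{\vec{j}}-\sum_{i=1}^k[p_i]_{j_i}$. $\mathsf{AMIN}_C$: given $p\in\mathbb{R}^{n\times k}$ and $\varepsilon>0$, return $\mathsf{MIN}_C(p)$ up to additive error $\varepsilon$. $\mathsf{SMIN}_C$: given $p\in\bar{\mathbb{R}}^{n\times k}$ and $\eta>0$, return $\mathrm{smin}_\eta$ over $\vec{j}\in[n]^k$ of $C_{\vec{j}}-\sum_{i=1}^k[p_i]_{j_i}$. Set oracles, for $S\subset[n]^k$. $\mathsf{MIN}_{C,S}$: given $p\in\mathbb{R}^{n\times k}$, return $\min_{\vec{j}\in S}-\sum_{i=1}^k[p_i]_{j_i}$. $\mathsf{AMIN}_{C,S}$: given $p\in\mathbb{R}^{n\times k}$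 and $\varepsilon>0$, return $\mathsf{MIN}_{C,S}(p)$ up to additive error $\varepsilon$. $\mathsf{SMIN}_{C,S}$: given $p\in\bar{\mathbb{R}}^{n\times k}$ and $\eta>0$, return $\mathrm{smin}_\eta$ over $\vec{j}\in S$ of $-\sum_{i=1}^k[p_i]_{j_i}$. Set-optimization structure: $C$ has exact, approximate, or soft set-optimization structure of complexity $\beta$ if $C_{\vec{j}}=\mathds{1}[\vec{j}\notin S]$ (the $0/1$ indicator) for a set $S\subset[n]^k$ for which there is an algorithm solving $\mathsf{MIN}_{C,S}$, $\mathsf{AMIN}_{C,S}$, or $\mathsf{SMIN}_{C,S}$, respectively, in $\beta$ time. *)

(* Defs.v *)
From HB Require Import structures.
From mathcomp Require Import all_boot all_order all_algebra.
From mathcomp Require Import all_classical all_reals all_analysis.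
Set Implicit Arguments.
Unset Strict Implicit.
Unset Printing Implicit Defensive.
Import Order.TTheory GRing.Theory Num.Theory.
Local Open Scope ring_scope.

(** * Tensors and oracle values (MathComp-Analysis)

    [n] is rendered by 'I_n, and a multi-index of [n]^k by a finite function
    'I_k -> 'I_n.  The matrix p = (p_1, ..., p_k) in R^(n x k) has p_i as its
    i-th column, so [p_i]_(j_i) is [p (j i) i].  Values are extended reals, a
    minimum over the empty set being +oo. *)

Definition idx (n k : nat) : finType := {ffun 'I_k -> 'I_n}.

Definition tensor (R : realType) (n k : nat) : Type := idx n k -> R.

Section Oracles.
Context {R : realType} {n k : nat}.
Local Open Scope ereal_scope.

Definition weight (p : 'M[\bar R]_(n, k)) (j : idx n k) : \bar R :=
  \sum_(i < k) p (j i) i.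

Definition MIN_C (C : tensor R n k) (p : 'M[\bar R]_(n, k)) : \bar R :=
  \big[mine/+oo]_(j : idx n k) ((C j)%:E - weight p j).

Definition MIN_S (S : {set idx n k}) (p : 'M[\bar R]_(n, k)) : \bar R :=
  \big[mine/+oo]_(j in S) (- weight p j).

(* [lne 0 = -oo] and [expeR -oo = 0]; hence smin of the empty family, or of a
   family that is constantly +oo, is +oo. *)
Definition smin (eta : R) (J : finType) (A : {set J}) (a : J -> \bar R) : \bar R :=
  - (eta^-1)%:E * lne (\sum_(j in A) expeR (- eta%:E * a j)).

Definition SMIN_C (C : tensor R n k) (p : 'M[\bar R]_(n, k)) (eta : R) : \bar R :=
  smin eta [set: idx n k] (fun j => (C j)%:E - weight p j).

Definition SMIN_S (S : {set idx n k}) (p : 'M[\bar R]_(n, k)) (eta : R) : \bar R :=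
  smin eta S (fun j => - weight p j).

End Oracles.

(** * A real RAM

    Integer variables and arrays (used for indexing) hold natural numbers; real
    variables and arrays hold elements of \bar R, with the operations of
    MathComp-Analysis, exp and ln included.  Variables and arrays are named by
    natural numbers, a program mentioning only finitely many names.  Every
    constant, memory access, arithmetic operation, assignment and comparison
    costs one unit.  Integers are only added, subtracted (truncated at 0) and
    compared, and reals are never rounded or converted to integers, which rules
    out the well-known unrealistic speed-ups of unit-cost models. *)

Inductive iexp : Type :=
  | IConst of nat
  | IVar of nat
  | IGet of nat & iexp
  | IAdd of iexp & iexp
  | ISub of iexp & iexp.

Inductive rexp (R : realType) : Type :=
  | RConst of \bar R
  | RVar of nat
  | RGet of nat & iexp
  | RAdd of rexp R & rexp R
  | RSub of rexp R & rexp R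
  | RMul of rexp R & rexp R
  | RDiv of rexp R & rexp R
  | RExp of rexp R
  | RLn of rexp R.

Inductive test (R : realType) : Type :=
  | ILt of iexp & iexp
  | RLt of rexp R & rexp R.

Inductive cmd (R : realType) : Type :=
  | Skip
  | ISet of nat & iexp
  | IPut of nat & iexp & iexp (* array name, position, value *)
  | RSet of nat & rexp R
  | RPut of nat & iexp & rexp R
  | Seq of cmd R & cmd R
  | If of test R & cmd R & cmd R
  | While of test R & cmd R.

Arguments RVar {R}.
Arguments RGet {R}.
Arguments ILt {R}.
Arguments Skip {R}.
Arguments ISet {R}.
Arguments IPut {R}.

Record state (R : realType) : Type := State {
  ivar : nat -> nat;
  iarr : nat -> nat -> nat;
  rvar : nat -> \bar R;
  rarr : nat -> nat -> \bar R }.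

Section Semantics.
Context {R : realType}.
Implicit Types (s : state R) (e : iexp) (f : rexp R) (b : test R) (c : cmd R).

Definition upd (T : Type) (g : nat -> T) (x : nat) (v : T) : nat -> T :=
  fun y => if y == x then v else g y.

Definition upd2 (T : Type) (g : nat -> nat -> T) (a m : nat) (v : T) :
    nat -> nat -> T :=
  upd g a (upd (g a) m v).

Definition set_ivar s x v := State (upd (ivar s) x v) (iarr s) (rvar s) (rarr s).
Definition set_iarr s a m v :=
  State (ivar s) (upd2 (iarr s) a m v) (rvar s) (rarr s).
Definition set_rvar s x v := State (ivar s) (iarr s) (upd (rvar s) x v) (rarr s).
Definition set_rarr s a m v :=
  State (ivar s) (iarr s) (rvar s) (upd2 (rarr s) a m v).

Fixpoint ieval s e : nat :=
  match e with
  | IConst m => m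
  | IVar x => ivar s x
  | IGet a e1 => iarr s a (ieval s e1)
  | IAdd e1 e2 => (ieval s e1 + ieval s e2)%N
  | ISub e1 e2 => (ieval s e1 - ieval s e2)%N
  end.

Fixpoint icost e : nat :=
  match e with
  | IConst _ | IVar _ => 1
  | IGet _ e1 => (icost e1).+1
  | IAdd e1 e2 | ISub e1 e2 => (icost e1 + icost e2).+1
  end.

Fixpoint reval s f : \bar R :=
  (match f with
   | RConst r => r
   | RVar x => rvar s x
   | RGet a e => rarr s a (ieval s e)
   | RAdd f1 f2 => reval s f1 + reval s f2
   | RSub f1 f2 => reval s f1 - reval s f2
   | RMul f1 f2 => reval s f1 * reval s f2
   | RDiv f1 f2 => reval s f1 / reval s f2
   | RExp f1 => expeR (reval s f1)
   | RLn f1 => lne (reval s f1)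
   end)%E.

Fixpoint rcost f : nat :=
  match f with
  | RConst _ | RVar _ => 1
  | RGet _ e => (icost e).+1
  | RAdd f1 f2 | RSub f1 f2 | RMul f1 f2 | RDiv f1 f2 =>
      (rcost f1 + rcost f2).+1
  | RExp f1 | RLn f1 => (rcost f1).+1
  end.

Definition teval s b : bool :=
  match b with
  | ILt e1 e2 => (ieval s e1 < ieval s e2)%N
  | RLt f1 f2 => (reval s f1 < reval s f2)%E
  end.

Definition tcost b : nat :=
  match b with
  | ILt e1 e2 => (icost e1 + icost e2).+1
  | RLt f1 f2 => (rcost f1 + rcost f2).+1
  end.

(* [exec c s t s']: started in [s], the program [c] halts in [s'] after time
   [t]. *)
Inductive exec : cmd R -> state R -> nat -> state R -> Prop :=
  | ExecSkip s : exec Skip s 0 s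
  | ExecISet s x e :
      exec (ISet x e) s (icost e).+1 (set_ivar s x (ieval s e))
  | ExecIPut s a e1 e2 :
      exec (IPut a e1 e2) s (icost e1 + icost e2).+1
        (set_iarr s a (ieval s e1) (ieval s e2))
  | ExecRSet s x f :
      exec (RSet x f) s (rcost f).+1 (set_rvar s x (reval s f))
  | ExecRPut s a e f :
      exec (RPut a e f) s (icost e + rcost f).+1
        (set_rarr s a (ieval s e) (reval s f))
  | ExecSeq c1 c2 s1 s2 s3 t1 t2 :
      exec c1 s1 t1 s2 -> exec c2 s2 t2 s3 ->
      exec (Seq c1 c2) s1 (t1 + t2) s3
  | ExecIf b c1 c2 s s' t :
      exec (if teval s b then c1 else c2) s t s' ->
      exec (If b c1 c2) s (tcost b + t) s'
  | ExecWhileStop b c s :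
      teval s b = false -> exec (While b c) s (tcost b) s
  | ExecWhileStep b c s1 s2 s3 t1 t2 :
      teval s1 b = true -> exec c s1 t1 s2 -> exec (While b c) s2 t2 s3 ->
      exec (While b c) s1 (tcost b + t1 + t2) s3.

(* The columns p_1, ..., p_k of p are stored consecutively in real array 0. *)
Definition input_cell n k (p : 'M[\bar R]_(n, k)) (m : nat) : \bar R :=
  match (insub (m %% n)%N : option 'I_n), (insub (m %/ n)%N : option 'I_k) with
  | Some j, Some i => p j i
  | _, _ => 0%E
  end.

(* The sizes n and k are in integer variables 0 and 1, the accuracy or
   temperature parameter of the query in real variable 0; everything else is 0. *)
Definition input n k (p : 'M[\bar R]_(n, k)) (r : R) : state R :=
  State (upd (upd (fun=> 0%N) 0 n) 1 k)
        (fun _ _ => 0%N)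
        (upd (fun=> 0%E) 0 r%:E)
        (upd (fun _ _ => 0%E) 0 (input_cell p)).

(* [A] halts on the given query within time [t], leaving in real variable 0 an
   answer that satisfies [post]. *)
Definition answers (A : cmd R) n k (p : 'M[\bar R]_(n, k)) (r : R) (t : nat)
    (post : \bar R -> Prop) : Prop :=
  exists u s, [/\ exec A (input p r) u s, (u <= t)%N & post (rvar s 0)].

Definition solves_MIN (A : cmd R) n k (val : 'M[\bar R]_(n, k) -> \bar R)
    (t : nat) : Prop :=
  forall p : 'M[R]_(n, k), let q := map_mx EFin p in
    answers A q 0 t (fun v => v = val q).

Definition solves_AMIN (A : cmd R) n k (val : 'M[\bar R]_(n, k) -> \bar R)
    (t : nat) : Prop :=
  forall (p : 'M[R]_(n, k)) (eps : R), 0 < eps -> let q := map_mx EFin p in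
    answers A q eps t
      (fun v => (val q - eps%:E <= v)%E /\ (v <= val q + eps%:E)%E).

(* The entries of a soft query lie in R u {-oo}. *)
Definition solves_SMIN (A : cmd R) n k (val : 'M[\bar R]_(n, k) -> R -> \bar R)
    (t : nat) : Prop :=
  forall (p : 'M[\bar R]_(n, k)) (eta : R),
    (forall j i, p j i < +oo)%E -> 0 < eta ->
    answers A p eta t (fun v => v = val p eta).

End Semantics.

(** * Set-optimization structure

    Tensors come in families indexed by an arbitrary type I (a single tensor
    being the case I = unit), and one program, which receives n and k, must serve
    the whole family; the complexity may depend on the member of the family. *)

Section Structure.
Context {R : realType} {I : Type} {n k : I -> nat}.
Variables (C : forall i, tensor R (n i) (k i)) (time : I -> nat).
Arguments C : clear implicits.

Definition MIN_computable : Prop :=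
  exists A : cmd R, forall i, solves_MIN A (MIN_C (C i)) (time i).

Definition AMIN_computable : Prop :=
  exists A : cmd R, forall i, solves_AMIN A (MIN_C (C i)) (time i).

Definition SMIN_computable : Prop :=
  exists A : cmd R, forall i, solves_SMIN A (SMIN_C (C i)) (time i).

Definition is_set_cost (S : forall i, {set idx (n i) (k i)}) : Prop :=
  forall i j, C i j = (j \notin S i)%:R.

Definition exact_set_opt_structure : Prop :=
  exists S : forall i, {set idx (n i) (k i)}, is_set_cost S /\
    exists A : cmd R, forall i, solves_MIN A (MIN_S (S i)) (time i).

Definition approx_set_opt_structure : Prop :=
  exists S : forall i, {set idx (n i) (k i)}, is_set_cost S /\
    exists A : cmd R, forall i, solves_AMIN A (MIN_S (S i)) (time i).

Definition soft_set_opt_structure : Prop :=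
  exists S : forall i, {set idx (n i) (k i)}, is_set_cost S /\
    exists A : cmd R, forall i, solves_SMIN A (SMIN_S (S i)) (time i).

End Structure.

Definition poly_bounded (T : nat -> nat -> nat) : Prop :=
  exists c : nat, forall n k : nat, (T n k <= c * (n + k + 1) ^ c)%N.

(* Main.v *)
Require Import Defs.
From HB Require Import structures.
From mathcomp Require Import all_boot all_order all_algebra.
From mathcomp Require Import all_classical all_reals all_analysis.
From mathcomp Require Import zify.

(** The weight of a multi-index splits over its k coordinates, so that
    optimization over all of [n]^k, without the set S, is easy: by
    distributivity,
      max_j weight p j = sum_i max_j [p_i]_j,
      sum_j exp (eta * weight p j) = prod_i sum_j exp (eta * [p_i]_j),
    and both right-hand sides take O(n k) operations. If C is the indicator of
    the complement of S, the oracle for C is recovered from the oracle for S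
    and one of these two numbers.

    Minimum: the multi-indices outside S cost 1 more, and charging that extra
    1 to those in S as well only adds values that never beat their own, so
      MIN_C p = min (MIN_S p) (1 - max_j weight p j)
    ([MIN_C_set]). The map v |-> min v c is 1-Lipschitz, so the same formula serves
    approximate oracles ([min_approx]).

    Soft minimum: write Z_S and Z for the sums of exp (eta * weight p j) over S
    and over all multi-indices. Those outside S carry the extra factor
    exp (- eta), so the sum for C is
      Z_S + exp (- eta) (Z - Z_S) = (1 - exp (- eta)) Z_S + exp (- eta) Z,
    and Z_S = exp (- eta * SMIN_S p), even if Z_S = 0, when SMIN_S p = +oo
    ([SMIN_C_set]).

    As for the machine, a program A for the set oracle may overwrite all of its
    input, so the number above is computed before A is run, in variables that A
    does not name. The frame property [exec_agree] says that such variables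
    neither influence A nor are changed by it; they are available because a
    program names finitely many variables and arrays ([width]). After A, a
    constant number of operations combines its answer with the stored number
    ([answers_around]). *)

Set Implicit Arguments.
Unset Strict Implicit.
Unset Printing Implicit Defensive.
Import Order.TTheory GRing.Theory Num.Theory.
Local Open Scope ring_scope.

(** * Recovering the oracle values for C from those for S *)

(* The convention -oo + +oo = -oo makes (max, +) a semiring on the whole of
   \bar R: -oo is absorbing, and + distributes over max even at infinite
   values. *)
HB.instance Definition _ (R : realType) :=
  Monoid.isMulLaw.Build (\bar R) -oo%E (@GRing.add (\bar R))
    (@addNye R) (@addeNy R).
HB.instance Definition _ (R : realType) :=
  Monoid.isAddLaw.Build (\bar R) (@GRing.add (\bar R))
    (@Order.max _ (\bar R)) (@adde_maxl R) (@adde_maxr R).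

Section Values.
Context {R : realType} {n k : nat}.
Implicit Types (S : {set idx n k}) (C : tensor R n k) (p : 'M[\bar R]_(n, k)).
Local Open Scope ereal_scope.

Definition max_weight p : \bar R := \sum_(i < k) \big[maxe/-oo]_(j < n) p j i.

(** Distributivity of + over max; it needs no case distinction for n = 0 or
    k = 0, as empty maxima and sums are the neutral elements. *)
Lemma max_weightE p : max_weight p = \big[maxe/-oo]_(j : idx n k) weight p j.
Proof. exact: bigA_distr_bigA. Qed.

Lemma one_sub_maxe (x y : \bar R) : 1 - maxe x y = mine (1 - x) (1 - y).
Proof.
have le1B (u v : \bar R) : u <= v -> 1 - v <= 1 - u.
  by move=> uv; rewrite leeD2l// leeN2.
case: (leP x y) => [xy|/ltW yx]; apply/esym; first exact/min_idPr/le1B.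
exact/min_idPl/le1B.
Qed.

(** A multi-index in S has cost 0, and min(- w, 1 - w) = - w, so that it may
    also be counted among those of cost 1. *)
Lemma MIN_C_set S C p : (forall j, C j = (j \notin S)%:R) ->
  MIN_C C p = mine (MIN_S S p) (1 - max_weight p).
Proof.
move=> CE; rewrite max_weightE.
rewrite (big_morph (fun x : \bar R => 1 - x) one_sub_maxe (id1 := +oo))//.
rewrite /MIN_C (eq_bigr (fun j =>
  mine (if j \in S then - weight p j else +oo) (1 - weight p j))); last first.
  move=> j _; rewrite CE; case: (j \in S) => /=; last by rewrite minye.
  by rewrite add0e; apply/esym/min_idPl; rewrite leeDr.
by rewrite big_split /= /MIN_S [in RHS]big_mkcond.
Qed.

(** The map v |-> min v c is monotone and satisfies
    min (v + eps) c <= min v c + eps. *)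
Lemma min_approx (m v c eps : \bar R) : 0 <= eps -> m - eps <= v <= m + eps ->
  mine m c - eps <= mine v c <= mine m c + eps.
Proof.
move=> eps0 /andP[mv vm].
apply/andP; split.
  rewrite le_min; apply/andP; split.
    by apply: le_trans mv; rewrite leeD2r// ge_min lexx.
  by rewrite (@le_trans _ _ (mine m c))// ?geeDl ?oppe_le0// ge_min lexx orbT.
rewrite [X in _ <= X + _]minEle; case: ifP => _.
  by rewrite (le_trans _ vm)// ge_min lexx.
by rewrite (@le_trans _ _ c) ?leeDl// ge_min lexx orbT.
Qed.

(** This product is the partition function of the Gibbs weights
    exp (eta * weight p j), in factored form. *)
Definition partition p (eta : R) : \bar R :=
  \prod_(i < k) \sum_(j < n) expeR (eta%:E * p j i).

(** Outside S the Gibbs weight gains a factor exp (- eta). The products and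
    quotients are written as the machine evaluates them. *)
Lemma SMIN_C_set S C p (eta : R) : (forall j, C j = (j \notin S)%:R) ->
  (forall j i, p j i < +oo) -> (0 < eta)%R ->
  SMIN_C C p eta = -1 / eta%:E *
    lne ((1 - expeR (-1 * eta%:E)) * expeR (-1 * eta%:E * SMIN_S S p eta)
         + expeR (-1 * eta%:E) * partition p eta).
Proof.
move=> CE poo eta0.
(* As no entry is +oo, all Gibbs weights are finite, so the sums can be
   manipulated in R; an entry -oo contributes the real number 0. *)
pose e := expR (- eta); pose g j i := fine (expeR (eta%:E * p j i)).
pose W (f : idx n k) : R := (\prod_(i < k) g (f i) i)%R.
have gE j i : expeR (eta%:E * p j i) = (g j i)%:E.
  rewrite /g; have := poo j i; case: (p j i) => [r| |] //= _.
  by rewrite mulr_infty gtr0_sg// mul1e.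
(* This holds for infinite values too, -oo being absorbing on both sides. *)
have gibbsD (x y : \bar R) :
    expeR (eta%:E * (x + y)) = expeR (eta%:E * x) * expeR (eta%:E * y).
  rewrite -expeRD; congr expeR.
  have etaNy : eta%:E * -oo = -oo by rewrite mulr_infty gtr0_sg// mul1e.
  have [->|xNy] := eqVneq x -oo; first by rewrite addNye etaNy addNye.
  have [->|yNy] := eqVneq y -oo; first by rewrite addeNy etaNy addeNy.
  by rewrite muleDr// ltninfty_adde_def// inE ltNye.
have WE (f : idx n k) : expeR (eta%:E * weight p f) = (W f)%:E.
  rewrite /W /weight -prodEFin.
  rewrite (big_morph (fun x => expeR (eta%:E * x)) gibbsD (id1 := 1));
    last by rewrite mule0 expeR0.
  by apply: eq_bigr => i _; rewrite gE.
have W0 f : (0 <= W f)%R.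
  by apply: prodr_ge0 => i _; rewrite fine_ge0// expeR_ge0.
have -> : partition p eta = (\sum_f W f)%R%:E.
  rewrite /partition /W -(bigA_distr_bigA (fun i j => g j i)) -prodEFin.
  apply: eq_bigr => i _.
  by rewrite -sumEFin; apply: eq_bigr => j _; exact: gE.
have opp_mul (x : \bar R) : - eta%:E * - x = eta%:E * x.
  by rewrite muleN mulNe oppeK.
have ZS : \sum_(j in S) expeR (- eta%:E * - weight p j) =
    (\sum_(j in S) W j)%R%:E.
  by rewrite -sumEFin; apply: eq_bigr => j _; rewrite opp_mul WE.
have -> : expeR (-1 * eta%:E * SMIN_S S p eta) = (\sum_(j in S) W j)%R%:E.
  rewrite /SMIN_S /smin ZS muleA -EFinN -!EFinM mulN1r mulrNN divff ?gt_eqF//.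
  by rewrite mul1e; apply/eqP; rewrite lneK_eq lee_fin sumr_ge0.
have -> : expeR (-1 * eta%:E) = e%:E by rewrite mulN1e.
rewrite -EFinB -!EFinM -EFinD inver gt_eqF// -EFinM mulN1r EFinN.
congr (_ * lne _).
pose V j := (if j \in S then W j else e * W j)%R.
rewrite (eq_bigr (fun j => (V j)%:E)); last first.
  move=> j _; rewrite CE /V; case: (j \in S) => /=.
    by rewrite add0e opp_mul WE.
  by rewrite muleDr// expeRD opp_mul WE EFinM mule1.
rewrite sumEFin; congr EFin.
rewrite (eq_bigl predT) => [|j]; last by rewrite inE.
rewrite [in RHS](bigID (mem S) predT) (bigID (mem S) predT) /=.
rewrite (eq_bigr W) => [|j jS]; last by rewrite /V ifT.
rewrite [X in (_ + X)%R](eq_bigr (fun j => e * W j)%R) => [|j jS]; last first.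
  by rewrite /V ifN.
by rewrite -mulr_sumr mulrDr mulrBl mul1r addrA subrK.
Qed.

End Values.

(** * Programs ignore the variables that they do not name *)

Section Frame.
Context {R : realType}.
Implicit Types (s : state R) (e : iexp) (f : rexp R) (b : test R) (c : cmd R).
Local Open Scope nat_scope.

Fixpoint iwidth e : nat :=
  match e with
  | IConst _ => 0
  | IVar x => x.+1
  | IGet a e1 => maxn a.+1 (iwidth e1)
  | IAdd e1 e2 | ISub e1 e2 => maxn (iwidth e1) (iwidth e2)
  end.

Fixpoint rwidth f : nat :=
  match f with
  | RConst _ => 0
  | RVar x => x.+1
  | RGet a e => maxn a.+1 (iwidth e)
  | RAdd f1 f2 | RSub f1 f2 | RMul f1 f2 | RDiv f1 f2 =>
      maxn (rwidth f1) (rwidth f2)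
  | RExp f1 | RLn f1 => rwidth f1
  end.

Definition twidth b : nat :=
  match b with
  | ILt e1 e2 => maxn (iwidth e1) (iwidth e2)
  | RLt f1 f2 => maxn (rwidth f1) (rwidth f2)
  end.

Fixpoint width c : nat :=
  match c with
  | Skip => 0
  | ISet x e => maxn x.+1 (iwidth e)
  | IPut a e1 e2 => maxn a.+1 (maxn (iwidth e1) (iwidth e2))
  | RSet x f => maxn x.+1 (rwidth f)
  | RPut a e f => maxn a.+1 (maxn (iwidth e) (rwidth f))
  | Seq c1 c2 => maxn (width c1) (width c2)
  | If b c1 c2 => maxn (twidth b) (maxn (width c1) (width c2))
  | While b c => maxn (twidth b) (width c)
  end.

Definition agree N s s' : Prop := forall x, x < N ->
  [/\ ivar s x = ivar s' x, iarr s x = iarr s' x,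
      rvar s x = rvar s' x & rarr s x = rarr s' x].

(** Only real variables need to survive: they hold the stored numbers. *)
Definition same_above N s s' : Prop := forall x, N <= x -> rvar s x = rvar s' x.

Lemma agree_set_ivar N s s' x v : N <= x -> agree N s s' ->
  agree N s (set_ivar s' x v).
Proof.
move=> Nx a y yN; rewrite /= /upd ifN; first exact: a.
by rewrite neq_ltn (leq_trans yN Nx).
Qed.

Lemma agree_set_rvar N s s' x v : N <= x -> agree N s s' ->
  agree N s (set_rvar s' x v).
Proof.
move=> Nx a y yN; rewrite /= /upd ifN; first exact: a.
by rewrite neq_ltn (leq_trans yN Nx).
Qed.

Lemma ieval_agree N s s' e : agree N s s' -> iwidth e <= N ->
  ieval s e = ieval s' e.
Proof.
move=> a; elim: e => //= [x xN|x e1 IH|e1 IH1 e2 IH2|e1 IH1 e2 IH2].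
- by case: (a x xN).
- by rewrite geq_max => /andP[xN /IH ->]; case: (a x xN) => _ ->.
- by rewrite geq_max => /andP[/IH1 -> /IH2 ->].
- by rewrite geq_max => /andP[/IH1 -> /IH2 ->].
Qed.

Lemma reval_agree N s s' f : agree N s s' -> rwidth f <= N ->
  reval s f = reval s' f.
Proof.
move=> a; elim: f => //=.
- by move=> x xN; case: (a x xN).
- by move=> x e; rewrite geq_max => /andP[xN /(ieval_agree a) ->];
    case: (a x xN) => _ _ _ ->.
1-4: by move=> f1 IH1 f2 IH2; rewrite geq_max => /andP[/IH1 -> /IH2 ->].
1-2: by move=> f1 IH1 /IH1 ->.
Qed.

Lemma teval_agree N s s' b : agree N s s' -> twidth b <= N ->
  teval s b = teval s' b.
Proof.
by move=> a; case: b => /= x y; rewrite geq_max => /andP[];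
  [move=> /(ieval_agree a) -> /(ieval_agree a) -> |
   move=> /(reval_agree a) -> /(reval_agree a) ->].
Qed.

(** The run of c depends only on names below its width and writes only
    there, so it can be replayed, step by step and in the same time, from any
    state that agrees on them. *)
Lemma exec_agree N c s t s' : exec c s t s' -> width c <= N ->
  forall s1, agree N s s1 ->
  exists s1', [/\ exec c s1 t s1', agree N s' s1' & same_above N s1 s1'].
Proof.
elim=> {c s t s'} /=.
- by move=> s _ s1 a; exists s1; split => //; exact: ExecSkip.
- move=> s x e; rewrite geq_max => /andP[xN eN] s1 a.
  exists (set_ivar s1 x (ieval s1 e)); split => //; first exact: ExecISet.
  move=> y yN; case: (a y yN) => ? ? ? ?; split => //=.
  by rewrite /upd (ieval_agree a eN); case: ifP.
- move=> s x e1 e2; rewrite !geq_max => /and3P[xN eN fN] s1 a.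
  exists (set_iarr s1 x (ieval s1 e1) (ieval s1 e2)); split => //.
    exact: ExecIPut.
  move=> y yN; case: (a y yN) => ? ? ? ?; split => //=.
  rewrite /upd2 /upd (ieval_agree a eN) (ieval_agree a fN).
  by case: (a x xN) => _ -> _ _; case: ifP.
- move=> s x e; rewrite geq_max => /andP[xN eN] s1 a.
  exists (set_rvar s1 x (reval s1 e)); split => //; first exact: ExecRSet.
    move=> y yN; case: (a y yN) => ? ? ? ?; split => //=.
    by rewrite /upd (reval_agree a eN); case: ifP.
  by move=> y Ny; rewrite /= /upd ifN// neq_ltn (leq_trans xN Ny) orbT.
- move=> s x e f; rewrite !geq_max => /and3P[xN eN fN] s1 a.
  exists (set_rarr s1 x (ieval s1 e) (reval s1 f)); split => //.
    exact: ExecRPut.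
  move=> y yN; case: (a y yN) => ? ? ? ?; split => //=.
  rewrite /upd2 /upd (ieval_agree a eN) (reval_agree a fN).
  by case: (a x xN) => _ _ _ ->; case: ifP.
- move=> c1 c2 s1 s2 s3 t1 t2 _ IH1 _ IH2.
  rewrite geq_max => /andP[w1 w2] r1 a1.
  have [r2 [e1 a2 f1]] := IH1 w1 _ a1; have [r3 [e2 a3 f2]] := IH2 w2 _ a2.
  exists r3; split => //; first exact: ExecSeq e1 e2.
  by move=> x Nx; rewrite f1// f2.
- move=> b c1 c2 s s' t _ IH; rewrite !geq_max => /and3P[wb w1 w2] s1 a.
  have wc : width (if teval s b then c1 else c2) <= N by case: ifP.
  have [s1' [e1 a1 f1]] := IH wc _ a.
  exists s1'; split => //; apply: ExecIf.
  by rewrite -(teval_agree a wb).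
- move=> b c s bF; rewrite geq_max => /andP[wb w1] s1 a.
  by exists s1; split => //; apply: ExecWhileStop; rewrite -(teval_agree a wb).
- move=> b c s1 s2 s3 t1 t2 bT _ IH1 _ IH2 w r1 a1.
  have := w; rewrite geq_max => /andP[wb wc].
  have [r2 [e1 a2 f1]] := IH1 wc _ a1; have [r3 [e2 a3 f2]] := IH2 w _ a2.
  exists r3; split => //.
    by apply: ExecWhileStep e1 e2; rewrite -(teval_agree a1 wb).
  by move=> x Nx; rewrite f1// f2.
Qed.

End Frame.

(** * Time-bounded execution *)

Section Runs.
Context {R : realType}.
Implicit Types (s : state R) (c : cmd R) (P Q : state R -> Prop).
Local Open Scope nat_scope.

(** A Hoare triple for total correctness, with an upper bound on the time. *)
Definition runs c s t Q : Prop := exists u s', [/\ exec c s u s', u <= t & Q s'].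

Lemma runs_weaken c s t t' Q Q' : runs c s t Q -> t <= t' ->
  (forall s', Q s' -> Q' s') -> runs c s t' Q'.
Proof.
by move=> [u [s' [e ut q]]] tt' QQ'; exists u, s'; split;
  [|exact: leq_trans ut tt'|exact: QQ'].
Qed.

Lemma runs_skip s Q : Q s -> runs Skip s 0 Q.
Proof. by move=> q; exists 0, s; split => //; exact: ExecSkip. Qed.

Lemma runs_iset s x e Q : Q (set_ivar s x (ieval s e)) ->
  runs (ISet x e) s (icost e).+1 Q.
Proof. by move=> q; do 2 eexists; split; [exact: ExecISet| |]. Qed.

Lemma runs_rset s x f Q : Q (set_rvar s x (reval s f)) ->
  runs (RSet x f) s (rcost f).+1 Q.
Proof. by move=> q; do 2 eexists; split; [exact: ExecRSet| |]. Qed.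

Lemma runs_seq c1 c2 s t1 t2 P Q : runs c1 s t1 P ->
  (forall s', P s' -> runs c2 s' t2 Q) -> runs (Seq c1 c2) s (t1 + t2) Q.
Proof.
move=> [u1 [s1 [e1 l1 p]]] /(_ _ p) [u2 [s2 [e2 l2 q]]].
exists (u1 + u2), s2; split => //; first exact: ExecSeq e1 e2.
exact: leq_add.
Qed.

Lemma runs_if b c1 c2 s t Q : runs (if teval s b then c1 else c2) s t Q ->
  runs (If b c1 c2) s (tcost b + t) Q.
Proof.
move=> [u [s' [e l q]]]; exists (tcost b + u), s'; split => //.
  exact: ExecIf.
by rewrite leq_add2l.
Qed.

Definition for_loop (x y : nat) c : cmd R :=
  Seq (ISet x (IConst 0))
    (While (ILt (IVar x) (IVar y)) (Seq c (ISet x (IAdd (IVar x) (IConst 1))))).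

(** Besides the body, a turn costs 3 for the test and 4 for the increment; the
    initialization costs 2 and the final test 3. *)
Lemma runs_for (Inv : nat -> state R -> Prop) m t x y c s :
  Inv 0 (set_ivar s x 0) ->
  (forall i s', Inv i s' -> ivar s' x = i /\ ivar s' y = m) ->
  (forall i s', i < m -> Inv i s' ->
     runs c s' t (fun s2 => Inv i.+1 (set_ivar s2 x (ivar s2 x).+1))) ->
  runs (for_loop x y c) s (m * (t + 7) + 5) (Inv m).
Proof.
move=> I0 Ixy Istep.
(* Induction on the number d of remaining turns. *)
have loop d i s' : i + d = m -> Inv i s' -> runs (While (ILt (IVar x) (IVar y))
    (Seq c (ISet x (IAdd (IVar x) (IConst 1))))) s' (d * (t + 7) + 3) (Inv m).
  elim: d i s' => [|d IH] i s' idm Ii; have [xi ym] := Ixy _ _ Ii.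
    exists 3, s'; split => //; last by rewrite -idm addn0.
    by apply: ExecWhileStop; rewrite /= xi ym -idm addn0 ltnn.
  have im : i < m by rewrite -idm addnS ltnS leq_addr.
  have [u1 [s1 [e1 l1 I1]]] := Istep _ _ im Ii.
  rewrite -[(ivar s1 x).+1]addn1 in I1.
  have [|u2 [s2 [e2 l2 I2]]] := IH i.+1 _ _ I1; first by rewrite addSnnS.
  exists (3 + (u1 + 4) + u2), s2; split => //; last by lia.
  apply: (ExecWhileStep _ _ e2); first by rewrite /= xi ym.
  exact: (ExecSeq e1 (ExecISet _ _ _)).
have -> : m * (t + 7) + 5 = 2 + (m * (t + 7) + 3) by lia.
apply: (@runs_seq _ _ _ _ _ (Inv 0)); first exact: runs_iset.
by move=> s' I0'; exact: (loop m 0).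
Qed.

End Runs.

(** * Folding the columns of the input *)

(** Here t bounds the time that it takes to process one entry. Moving on to the
    next cell and running the inner loop add 4 + 7 to it; a turn of the outer
    loop takes 2 + 4 for setting and using the value of a column, 5 for starting
    and leaving the inner loop, and 7 for the loop itself. *)
Definition fold_time (n k t : nat) : nat := (k * (n * (t + 11) + 18) + 9)%N.

Section Fold.
Context {R : realType} {n k : nat} (p : 'M[\bar R]_(n, k)) (r : R).
Context (u1 u2 : \bar R) (op1 : Monoid.law u1) (op2 : Monoid.law u2).
Context (g : \bar R -> \bar R) (N t : nat) (acc : cmd R) (comb : rexp R).
Local Open Scope nat_scope.

Lemma input_cellE (i : 'I_k) (j : 'I_n) : input_cell p (i * n + j) = p j i.
Proof.
have n0 : 0 < n by exact: leq_ltn_trans (ltn_ord j).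
rewrite /input_cell modnMDl modn_small// divnMDl// divn_small// addn0.
by rewrite !valK.
Qed.

(** Column i of p occupies the cells i * n, ..., i * n + n - 1 of real array 0.
    As the machine cannot multiply integers, integer variable N walks through
    all cells in order. Integer variables N + 1 and N + 2 count the columns and
    the entries of a column, real variables N and N + 1 accumulate the total
    and the value of the current column. *)
Definition fold_cols : cmd R :=
  Seq (RSet N (RConst u2)) (Seq (ISet N (IConst 0))
    (for_loop N.+1 1
      (Seq (RSet N.+1 (RConst u1))
        (Seq (for_loop N.+2 0
               (Seq acc (ISet N (IAdd (IVar N) (IConst 1)))))
          (RSet N comb))))).

Hypothesis N2 : 2 <= N.
Hypothesis accP : forall s Q, rvar s 0 = r%:E ->
  Q (set_rvar s N.+1 (op1 (rvar s N.+1) (g (rarr s 0 (ivar s N))))) ->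
  runs acc s t Q.
Hypothesis combE : forall s, reval s comb = op2 (rvar s N) (rvar s N.+1).
Hypothesis comb_cost : rcost comb = 3.

Let s0 := input p r.
Let col i m := \big[op1/u1]_(0 <= j < m) g (input_cell p (i * n + j)).
Let tot m := \big[op2/u2]_(0 <= i < m) col i n.

Lemma runs_fold_cols : runs fold_cols s0 (fold_time n k t) (fun s =>
  agree N s0 s /\ rvar s N = \big[op2/u2]_(i < k) \big[op1/u1]_(j < n) g (p j i)).
Proof.
have [N0 N1] : 0 < N /\ 1 < N by split => //; exact: ltn_trans N2.
pose outer i (s : state R) := [/\ agree N s0 s, ivar s N = i * n,
  ivar s N.+1 = i & rvar s N = tot i].
pose inner i j (s : state R) := [/\ agree N s0 s, ivar s N = i * n + j,
  ivar s N.+1 = i /\ ivar s N.+2 = j, rvar s N = tot i &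
  rvar s N.+1 = col i j].
have agree_n s : agree N s0 s -> ivar s 0 = n by move=> a; case: (a 0 N0).
have agree_k s : agree N s0 s -> ivar s 1 = k by move=> a; case: (a 1 N1).
have agree_r s : agree N s0 s -> rvar s 0 = r%:E.
  by move=> a; case: (a 0 N0).
have agree_p s : agree N s0 s -> rarr s 0 = input_cell p.
  by move=> a; case: (a 0 N0) => _ _ _ <-.
have ne1 x : (x == x.+1) = false by lia.
have ne2 x : (x == x.+2) = false by lia.
have ne3 x : (x.+1 == x) = false by lia.
have ne4 x : (x.+2 == x) = false by lia.
have updE (T : Type) (f : nat -> T) x v y :
  upd f x v y = if y == x then v else f y by [].
have simp := (updE, eqxx, eqSS, ne1, ne2, ne3, ne4).
have inner_loop i s : inner i 0 (set_ivar s N.+2 0) -> runs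
    (for_loop N.+2 0 (Seq acc (ISet N (IAdd (IVar N) (IConst 1))))) s
    (n * (t + 4 + 7) + 5) (inner i n).
  move=> I0; apply: runs_for => //.
    by move=> j s' [a _ [_ ->] _ _]; rewrite agree_n.
  move=> j s' jn [a ptr [ci cj] rN rS].
  apply: (runs_seq (P := fun s2 => s2 = set_rvar s' N.+1
    (op1 (rvar s' N.+1) (g (rarr s' 0 (ivar s' N)))))).
    by apply: accP => //; exact: agree_r.
  move=> _ ->; apply: runs_iset; split => /=.
  - do 2 (apply: agree_set_ivar; first by lia).
    by apply: agree_set_rvar => //; lia.
  - by rewrite !simp ptr addn1 addnS.
  - by rewrite !simp ci cj.
  - by rewrite !simp.
  - by rewrite !simp rS ptr (agree_p _ a) /col big_nat_recr.
have -> : fold_time n k t =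
    2 + (2 + (k * (2 + (n * (t + 4 + 7) + 5 + 4) + 7) + 5)).
  by rewrite /fold_time; lia.
apply: (runs_seq (P := fun s => s = set_rvar s0 N u2)); first exact: runs_rset.
move=> _ ->.
apply: (runs_seq (P := fun s => s = set_ivar (set_rvar s0 N u2) N 0)).
  exact: runs_iset.
move=> _ ->; apply: (@runs_weaken _ _ _
  (k * (2 + (n * (t + 4 + 7) + 5 + 4) + 7) + 5) _ (outer k)) => //.
  apply: runs_for => //.
  - split => /=; rewrite ?simp ?mul0n// /tot ?big_geq//.
    do 2 (apply: agree_set_ivar; first by lia).
    exact: agree_set_rvar.
  - by move=> i s' [a _ -> _]; rewrite agree_k.
  move=> i s ik [a ptr ci rN].
  apply: (runs_seq (P := fun s2 => s2 = set_rvar s N.+1 u1)).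
    exact: runs_rset.
  move=> _ ->; apply: (runs_seq (P := inner i n)).
    apply: inner_loop; split => /=; rewrite ?simp ?addn0 /col ?big_geq//.
    apply: agree_set_ivar; first by lia.
    by apply: agree_set_rvar => //; lia.
  move=> s' [a' ptr' [ci' _] rN' rS']; rewrite -[4]/(3.+1) -comb_cost.
  apply: runs_rset; split => /=; rewrite ?simp ?ci' ?ptr' ?mulSn 1?addnC//.
  - apply: agree_set_ivar; first by lia.
    exact: agree_set_rvar.
  - by rewrite combE rN' rS' /tot big_nat_recr.
move=> s [a _ _ ->]; split => //; rewrite /tot big_mkord; apply: eq_bigr => i _.
by rewrite /col big_mkord; apply: eq_bigr => j _; rewrite input_cellE.
Qed.

End Fold.

(** * The programs for C *)

(** The relation F is what is remembered, while A runs, of the two numbers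
    stored in the real variables N and N + 1. *)
Lemma answers_around {R : realType} n k (p : 'M[\bar R]_(n, k)) (r : R)
    (A pre post : cmd R) N t tpre tpost t' (ans Q : \bar R -> Prop)
    (F : \bar R -> \bar R -> Prop) :
  (0 < N)%N -> (width A <= N)%N -> answers A p r t ans ->
  runs pre (input p r) tpre
    (fun s => agree N (input p r) s /\ F (rvar s N) (rvar s N.+1)) ->
  (forall s, ans (rvar s 0%N) -> F (rvar s N) (rvar s N.+1) ->
     runs post s tpost (fun s' => Q (rvar s' 0%N))) ->
  (tpre + tpost <= t')%N -> answers (Seq pre (Seq A post)) p r (t + t')%N Q.
Proof.
move=> N0 wA [u [s [eA ut ansv]]] Hpre Hpost le_t'.
suff H : runs (Seq pre (Seq A post)) (input p r) (tpre + (t + tpost))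
    (fun s' => Q (rvar s' 0%N)).
  by apply: runs_weaken H _ _ => //; rewrite addnCA leq_add2l.
apply: runs_seq Hpre _ => s1 [a1 F1].
have [s2 [eA2 a2 f2]] := exec_agree eA wA a1.
apply: (runs_seq (P := fun s' => s' = s2)); first by exists u, s2.
move=> _ ->; apply: Hpost; first by case: (a2 0%N N0) => _ _ <-.
by rewrite -!f2.
Qed.

Section Programs.
Context {R : realType} {n k : nat} (p : 'M[\bar R]_(n, k)) (N : nat).
Hypothesis N2 : (2 <= N)%N.

Definition max_weight_prog : cmd R :=
  fold_cols -oo%E 0%E N
    (If (RLt (RVar N.+1) (RGet 0 (IVar N))) (RSet N.+1 (RGet 0 (IVar N))) Skip)
    (RAdd (RVar N) (RVar N.+1)).

Definition combine_min : cmd R :=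
  If (RLt (RVar 0) (RSub (RConst 1%E) (RVar N))) Skip
    (RSet 0 (RSub (RConst 1%E) (RVar N))).

(** The temperature is saved in real variable N + 1, which is free once the
    product is known, because A may overwrite real variable 0. *)
Definition partition_prog : cmd R :=
  Seq (fold_cols 0%E 1%E N
        (RSet N.+1 (RAdd (RVar N.+1) (RExp (RMul (RVar 0) (RGet 0 (IVar N))))))
        (RMul (RVar N) (RVar N.+1)))
    (RSet N.+1 (RVar 0)).

(** Evaluates the right-hand side of [SMIN_C_set]. *)
Definition combine_smin : cmd R :=
  let opp_eta := RMul (RConst (-1)%E) (RVar N.+1) in
  RSet 0 (RMul (RDiv (RConst (-1)%E) (RVar N.+1)) (RLn (RAdd
    (RMul (RSub (RConst 1%E) (RExp opp_eta)) (RExp (RMul opp_eta (RVar 0))))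
    (RMul (RExp opp_eta) (RVar N))))).

Lemma set_rvar_id (s : state R) x : set_rvar s x (rvar s x) = s.
Proof.
case: s => a b c d; congr State; apply/funext => y /=.
by rewrite /upd; case: eqP => // ->.
Qed.

Lemma runs_max_weight (r : R) : runs max_weight_prog (input p r)
  (fold_time n k 7)
  (fun s => agree N (input p r) s /\ rvar s N = max_weight p).
Proof.
apply: (@runs_fold_cols _ _ _ p r _ _ (@Order.max _ (\bar R)) +%E id)
  => // s Q _ q.
apply: (@runs_if _ _ _ _ _ 3) => /=.
move: q; rewrite /= /Order.max; case: ifP => _ q; first exact: runs_rset.
rewrite set_rvar_id in q.
by apply: (@runs_weaken _ _ _ 0 _ Q) => //; exact: runs_skip.
Qed.

Lemma runs_partition (eta : R) : runs partition_prog (input p eta)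
  (fold_time n k 8 + 2)%N
  (fun s => agree N (input p eta) s /\
     (rvar s N = partition p eta /\ rvar s N.+1 = eta%:E)).
Proof.
apply: runs_seq.
  apply: (@runs_fold_cols _ _ _ p eta _ _ +%E *%E
    (fun x => expeR (eta%:E * x))%E) => // s Q eta_s q.
  by apply: runs_rset; rewrite /= eta_s.
move=> s [a Z]; apply: runs_rset; split; first by apply: agree_set_rvar.
rewrite /= /upd eqxx ifN ?neq_ltn ?leqnn//; split=> //.
by case: (a 0%N _) => [|_ _ <- _] //; exact: ltn_trans N2.
Qed.

Lemma runs_combine_min (s : state R) (Q : \bar R -> Prop) :
  Q (mine (rvar s 0) (1 - rvar s N))%E ->
  runs combine_min s 9 (fun s' => Q (rvar s' 0)).
Proof.
move=> q; apply: (@runs_if _ _ _ _ _ 4) => /=.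
move: q; rewrite minElt; case: ifP => _ q; last exact: runs_rset.
exact: (@runs_weaken _ _ _ 0 _ (fun s0 => Q (rvar s0 0)) _ (runs_skip q)).
Qed.

End Programs.

(** The constant 30 covers saving the temperature and the final combination,
    and 8 bounds the time that either program spends on one entry. *)
Definition overhead (n k : nat) : nat := (fold_time n k 8 + 30)%N.

Lemma poly_bounded_overhead : poly_bounded overhead.
Proof.
exists 60%N => n k; apply: (@leq_trans (60 * (n + k + 1) ^ 2)%N).
  by rewrite /overhead /fold_time -mulnn; nia.
by rewrite leq_mul2l leq_pexp2l// addn1.
Qed.

Section OracleReduction.
Context {R : realType}.
Implicit Type A : cmd R.

(** At least 2, to spare the integer variables 0 and 1, which hold n and k. *)
Definition scratch A : nat := maxn 2 (width A).

Definition wrap_min A : cmd R :=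
  Seq (max_weight_prog (scratch A)) (Seq A (combine_min (scratch A))).

Definition wrap_smin A : cmd R :=
  Seq (partition_prog (scratch A)) (Seq A (combine_smin (scratch A))).

Lemma answers_wrap_min A n k (p : 'M[\bar R]_(n, k)) (r : R) t
    (ans Q : \bar R -> Prop) :
  answers A p r t ans -> (forall v, ans v -> Q (mine v (1 - max_weight p))%E) ->
  answers (wrap_min A) p r (t + overhead n k) Q.
Proof.
move=> Aans ansQ.
apply: (answers_around (N := scratch A) (F := fun c _ => c = max_weight p)
  _ _ Aans).
- by rewrite leq_max.
- exact: leq_maxr.
- exact: runs_max_weight (leq_maxl _ _) _.
- by move=> s v c; apply: runs_combine_min; rewrite c; exact: ansQ.
- by rewrite /overhead /fold_time; nia.
Qed.

Lemma answers_wrap_smin A n k (p : 'M[\bar R]_(n, k)) (eta : R) t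
    (ans Q : \bar R -> Prop) :
  answers A p eta t ans ->
  (forall v, ans v -> Q (-1 / eta%:E * lne (
     (1 - expeR (-1 * eta%:E)) * expeR (-1 * eta%:E * v)
     + expeR (-1 * eta%:E) * partition p eta)))%E ->
  answers (wrap_smin A) p eta (t + overhead n k) Q.
Proof.
move=> Aans ansQ.
apply: (answers_around (N := scratch A)
  (F := fun Z h => Z = partition p eta /\ h = eta%:E) _ _ Aans).
- by rewrite leq_max.
- exact: leq_maxr.
- exact: runs_partition (leq_maxl _ _) _.
- move=> s v [Z h]; apply: runs_rset.
  by rewrite /= /upd eqxx Z h; exact: ansQ.
- by rewrite /overhead -addnA leq_add2l.
Qed.

End OracleReduction.

Theorem theorem6p8 (R : realType) :
  exists T : nat -> nat -> nat, poly_bounded T /\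
    forall (I : Type) (n k : I -> nat) (C : forall i : I, tensor R (n i) (k i))
      (beta : I -> nat),
      (exact_set_opt_structure C beta ->
         MIN_computable C (fun i => beta i + T (n i) (k i))%N) /\
      (approx_set_opt_structure C beta ->
         AMIN_computable C (fun i => beta i + T (n i) (k i))%N) /\
      (soft_set_opt_structure C beta ->
         SMIN_computable C (fun i => beta i + T (n i) (k i))%N).
Proof.
exists overhead; split; first exact: poly_bounded_overhead.
move=> I n k C beta; split; [|split] => -[S [CE [A solA]]].
- exists (wrap_min A) => i p q.
  apply: answers_wrap_min (solA i p) _ => v ->.
  by rewrite -(MIN_C_set _ (CE i)).
- exists (wrap_min A) => i p eps eps0 q.
  apply: answers_wrap_min (solA i p eps eps0) _ => v /andP v_approx.
  rewrite (MIN_C_set _ (CE i)); apply/andP; apply: min_approx v_approx.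
  by rewrite lee_fin ltW.
- exists (wrap_smin A) => i p eta poo eta0.
  apply: answers_wrap_smin (solA i p eta poo eta0) _ => v ->.
  by rewrite (SMIN_C_set (CE i)).
Qed.
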